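(* Let $\mathcal C\subset\mathbb R^n$ be nonempty, compact and convex; let $f:\mathbb R^n\to\mathbb R$ be continuously differentiable on an open set containing $\mathcal C$ with $\nabla f$ Lipschitz-continuous on $\mathcal C$ with constant $L_{\nabla f}>0$; let $T:\mathbb R^n\to\mathbb R^m$ be linear; and let $g:\mathbb R^m\to\mathbb R$ be $L_g$-Lipschitz on $\mathbb R^m$ and $\rho$-weakly convex for some $\rho\ge0$. Assume the proximal lift property: there is $M_{\mathrm{lift}}>0$ such that for every $x\in\mathcal C$ and every $\beta\in\,]0,\rho^{-1}[$ there exists $z=z(x,\beta)\in\mathcal C$ with $Tz=\mathrm{prox}_{\beta g}(Tx)$ and $\|z-x\|_2\le M_{\mathrm{lift}}\|Tz-Tx\|_2$. Let $x\in\mathcal C$, $\beta\in\,]0,\rho^{-1}[$, let $z=z(x,\beta)$ be such a point, and set $\xi_\beta(x):=\nabla g^\beta(Tx)$. Then $\xi_\beta(x)\in\partial g(Tz)$ and $$\mathrm{gap}(z;\xi_\beta(x))\le\mathrm{gap}^\beta(x)+C_{\mathrm{lift}}\,\beta,\qquad C_{\mathrm{lift}}:=M_{\mathrm{lift}}L_g\left(L_f+L_g\|T^*\|_{\mathrm{op}}+L_{\nabla f}D_{\mathcal C}\right).$$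
   Context: Conventions: $\rho^{-1}=+\infty$ if $\rho=0$. $\rho$-weakly convex means $g+\frac{\rho}{2}\|\cdot\|_2^2$ is convex. $\partial g$ is the Clarke subdifferential. $D_{\mathcal C}=\sup_{x,y\in\mathcal C}\|x-y\|_2$; $L_f=\sup_{x\in\mathcal C}\|\nabla f(x)\|_2$. For $\beta\in\,]0,\rho^{-1}[$: $\mathrm{prox}_{\beta g}(y)=\operatorname{argmin}_u\{g(u)+\frac1{2\beta}\|u-y\|_2^2\}$ (unique), and the Moreau envelope $g^\beta(y)=\min_u\{g(u)+\frac1{2\beta}\|u-y\|_2^2\}$ is continuously differentiable with $\nabla g^\beta(y)=\beta^{-1}(y-\mathrm{prox}_{\beta g}(y))$. Smoothed Frank-Wolfe gap: for $x\in\mathcal C$, $\mathrm{gap}^\beta(x):=\max_{s\in\mathcal C}\langle\nabla f(x)+T^*\nabla g^\beta(Tx),x-s\rangle$. Nonsmooth Frank-Wolfe subgradient gap: for $\xi\in\partial g(Tx)$, $\mathrm{gap}(x;\xi):=\max_{s\in\mathcal C}\langle\nabla f(x)+T^*\xi,x-s\rangle$. *)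

(* Defs.v *)
From HB Require Import structures.
From mathcomp Require Import all_boot all_order all_algebra.
From mathcomp Require Import all_classical all_reals all_analysis.

Set Implicit Arguments.
Unset Strict Implicit.
Unset Printing Implicit Defensive.

Import Order.TTheory GRing.Theory Num.Theory.
Import numFieldNormedType.Exports.

Local Open Scope classical_set_scope.
Local Open Scope ring_scope.

(* R^n is 'rV[R]_n.  The library norm `|u| on 'rV[R]_n is the sup norm: it is
   used only through the topology and the notion of differentiability it
   induces, and every metric quantity is expressed with norm2. *)

Definition dot (R : realType) (n : nat) (u v : 'rV[R]_n) : R :=
  \sum_(i < n) u 0 i * v 0 i.

Definition norm2 (R : realType) (n : nat) (u : 'rV[R]_n) : R :=
  Num.sqrt (dot u u).

Definition gradient (R : realType) (n : nat) (f : 'rV[R]_n -> R)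
    (x : 'rV[R]_n) : 'rV[R]_n :=
  \row_(i < n) 'd f x (delta_mx 0 i).

Definition continuously_differentiable_on (R : realType) (n : nat)
    (U : set 'rV[R]_n) (f : 'rV[R]_n -> R) : Prop :=
  (forall x, U x -> differentiable f x) /\ {within U, continuous (gradient f)}.

Definition lipschitz2_on (R : realType) (n k : nat) (A : set 'rV[R]_n)
    (L : R) (h : 'rV[R]_n -> 'rV[R]_k) : Prop :=
  forall x y, A x -> A y -> norm2 (h x - h y) <= L * norm2 (x - y).

Definition lipschitz2 (R : realType) (m : nat) (L : R) (g : 'rV[R]_m -> R) :
    Prop :=
  0 <= L /\ forall u v, `|g u - g v| <= L * norm2 (u - v).

Definition adjoint (R : realType) (n m : nat)
    (T : {linear 'rV[R]_n -> 'rV[R]_m}) (y : 'rV[R]_m) : 'rV[R]_n :=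
  y *m (lin1_mx T)^T.

Lemma adjointP (R : realType) (n m : nat)
    (T : {linear 'rV[R]_n -> 'rV[R]_m}) (x : 'rV[R]_n) (y : 'rV[R]_m) :
  dot (T x) y = dot x (adjoint T y).
Proof.
have dotE k (u v : 'rV[R]_k) : dot u v = (u *m v^T) 0 0.
  by rewrite mxE; apply: eq_bigr => i _; rewrite mxE.
by rewrite !dotE /adjoint trmx_mul trmxK mulmxA mul_rV_lin1.
Qed.

Definition op_norm (R : realType) (m n : nat) (A : 'rV[R]_m -> 'rV[R]_n) : R :=
  sup [set norm2 (A y) | y in [set y | norm2 y <= 1]].

Definition weakly_convex (R : realType) (m : nat) (rho : R)
    (g : 'rV[R]_m -> R) : Prop :=
  convex_function setT (fun u => g u + rho / 2 * norm2 u ^+ 2).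

(* limsup of (g (y' + t v) - g y') / t as y' --> y and t --> 0+ *)
Definition clarke_derivative (R : realType) (m : nat) (g : 'rV[R]_m -> R)
    (y v : 'rV[R]_m) : \bar R :=
  limf_esup (fun p : 'rV[R]_m * R => ((g (p.1 + p.2 *: v) - g p.1) / p.2)%:E)
    (filter_prod (nbhs y) (0 : R)^'+).

Definition clarke_subdifferential (R : realType) (m : nat)
    (g : 'rV[R]_m -> R) (y : 'rV[R]_m) : set 'rV[R]_m :=
  [set xi | forall v, ((dot xi v)%:E <= clarke_derivative g y v)%E].

(* beta \in ]0, rho^-1[; the inverse is that of \bar R, for which 0^-1 = +oo *)
Definition smoothing_parameter (R : realType) (rho beta : R) : Prop :=
  (0 < beta) /\ (beta%:E < rho%:E^-1)%E.

Definition prox_objective (R : realType) (m : nat) (beta : R)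
    (g : 'rV[R]_m -> R) (y u : 'rV[R]_m) : R :=
  g u + (2 * beta)^-1 * norm2 (u - y) ^+ 2.

Definition prox (R : realType) (m : nat) (beta : R) (g : 'rV[R]_m -> R)
    (y : 'rV[R]_m) : 'rV[R]_m :=
  get [set u | forall v, prox_objective beta g y u <= prox_objective beta g y v].

Definition moreau (R : realType) (m : nat) (beta : R) (g : 'rV[R]_m -> R)
    (y : 'rV[R]_m) : R :=
  inf (range (prox_objective beta g y)).

Definition fw_gap (R : realType) (n : nat) (C : set 'rV[R]_n)
    (w x : 'rV[R]_n) : R :=
  sup [set dot w (x - s) | s in C].

Definition smoothed_gap (R : realType) (n m : nat) (C : set 'rV[R]_n)
    (f : 'rV[R]_n -> R) (T : {linear 'rV[R]_n -> 'rV[R]_m})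
    (g : 'rV[R]_m -> R) (beta : R) (x : 'rV[R]_n) : R :=
  fw_gap C (gradient f x + adjoint T (gradient (moreau beta g) (T x))) x.

Definition subgradient_gap (R : realType) (n m : nat) (C : set 'rV[R]_n)
    (f : 'rV[R]_n -> R) (T : {linear 'rV[R]_n -> 'rV[R]_m})
    (x : 'rV[R]_n) (xi : 'rV[R]_m) : R :=
  fw_gap C (gradient f x + adjoint T xi) x.

Definition diameter (R : realType) (n : nat) (C : set 'rV[R]_n) : R :=
  sup [set norm2 (p.1 - p.2) | p in C `*` C].

Definition max_gradient_norm (R : realType) (n : nat) (C : set 'rV[R]_n)
    (f : 'rV[R]_n -> R) : R :=
  sup [set norm2 (gradient f x) | x in C].

Definition lift_point (R : realType) (n m : nat) (C : set 'rV[R]_n)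
    (T : {linear 'rV[R]_n -> 'rV[R]_m}) (g : 'rV[R]_m -> R) (M beta : R)
    (x z : 'rV[R]_n) : Prop :=
  [/\ C z, T z = prox beta g (T x) & norm2 (z - x) <= M * norm2 (T z - T x)].

Definition proximal_lift (R : realType) (n m : nat) (C : set 'rV[R]_n)
    (T : {linear 'rV[R]_n -> 'rV[R]_m}) (g : 'rV[R]_m -> R) (rho M : R) : Prop :=
  forall x beta, C x -> smoothing_parameter rho beta ->
    exists z, lift_point C T g M beta x z.

Definition lift_constant (R : realType) (n m : nat) (C : set 'rV[R]_n)
    (f : 'rV[R]_n -> R) (T : {linear 'rV[R]_n -> 'rV[R]_m})
    (Lgradf Lg M : R) : R :=
  M * Lg * (max_gradient_norm C f + Lg * op_norm (adjoint T)
            + Lgradf * diameter C).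

(* Main.v *)
From HB Require Import structures.
Require Import Defs.
From mathcomp Require Import all_boot all_order all_algebra.
From mathcomp Require Import all_classical all_reals all_analysis.
From mathcomp Require Import ring lra.

Import Order.TTheory GRing.Theory Num.Theory.
Import numFieldNormedType.Exports.

Local Open Scope classical_set_scope.
Local Open Scope ring_scope.

(* With p := prox (T x) = T z, minimality of p for g + |. - T x|^2 / (2 beta)
   makes (T x - p) / beta a Clarke subgradient of g at p, bounded by Lg. Weak
   convexity is needed only to identify this vector with the gradient of the
   Moreau envelope M: the quadratic growth of the objective around p gives
   |M (y + h) - M y - <xi, h>| = O(|h|^2). Hence |z - x| <= M_lift Lg beta, and
   the two gaps, whose linear forms differ by the gradients of f at z and x
   only, are compared term by term. *)

(** * Euclidean inner product and norm, and comparison with the sup norm *)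

Section Euclidean.
Context {R : realType} {n : nat}.
Implicit Types (a : R) (u v w : 'rV[R]_n).

Lemma dotC u v : dot u v = dot v u.
Proof. by apply: eq_bigr => i _; rewrite mulrC. Qed.

Lemma dotDl u v w : dot (u + v) w = dot u w + dot v w.
Proof. by rewrite -big_split; apply: eq_bigr => i _; rewrite mxE mulrDl. Qed.

Lemma dotZl a u v : dot (a *: u) v = a * dot u v.
Proof. by rewrite mulr_sumr; apply: eq_bigr => i _; rewrite mxE mulrA. Qed.

Lemma dotDr u v w : dot u (v + w) = dot u v + dot u w.
Proof. by rewrite dotC dotDl !(dotC u). Qed.

Lemma dotZr a u v : dot u (a *: v) = a * dot u v.
Proof. by rewrite dotC dotZl dotC. Qed.

Lemma dotNl u v : dot (- u) v = - dot u v.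
Proof. by rewrite -scaleN1r dotZl mulN1r. Qed.

Lemma dotNr u v : dot u (- v) = - dot u v.
Proof. by rewrite dotC dotNl dotC. Qed.

Definition dotE := (dotDl, dotDr, dotZl, dotZr, dotNl, dotNr).

Lemma dot_ge0 u : 0 <= dot u u.
Proof. by apply: sumr_ge0 => i _; rewrite -expr2 sqr_ge0. Qed.

Lemma norm2_ge0 u : 0 <= norm2 u.
Proof. exact: sqrtr_ge0. Qed.

Lemma sqr_norm2 u : norm2 u ^+ 2 = dot u u.
Proof. by rewrite sqr_sqrtr// dot_ge0. Qed.

Lemma norm2_eq0 u : norm2 u = 0 -> u = 0.
Proof.
move=> u0; apply/rowP => i; rewrite mxE; apply/eqP; rewrite -sqrf_eq0.
have : \sum_(j < n) u 0 j * u 0 j = 0.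
  by rewrite -[LHS]/(dot u u) -sqr_norm2 u0 expr0n.
move/psumr_eq0P => h; apply/eqP; rewrite expr2 h// => j _.
by rewrite -expr2 sqr_ge0.
Qed.

Lemma dot_le_norm2 u v : dot u v <= norm2 u * norm2 v.
Proof.
have [/norm2_eq0->|u0] := eqVneq (norm2 u) 0.
  by rewrite -(scale0r u) dotZl mul0r mulr_ge0 ?norm2_ge0.
have [/norm2_eq0->|v0] := eqVneq (norm2 v) 0.
  by rewrite -(scale0r u) dotZr mul0r mulr_ge0 ?norm2_ge0.
have uv : 0 < norm2 u * norm2 v by rewrite mulr_gt0// lt0r norm2_ge0 ?u0 ?v0.
(* The expansion is [2 |u| |v| (|u| |v| - <u, v>)], to be divided by [|u| |v| > 0]. *)
have := dot_ge0 (norm2 v *: u - norm2 u *: v).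
rewrite !dotE -!sqr_norm2 (dotC v u) => h.
rewrite -(ler_pM2l uv); lra.
Qed.

Lemma norm2Z a u : norm2 (a *: u) = `|a| * norm2 u.
Proof. by rewrite /norm2 !dotE mulrA -expr2 sqrtrM ?sqr_ge0// sqrtr_sqr. Qed.

Lemma norm2N u : norm2 (- u) = norm2 u.
Proof. by rewrite -scaleN1r norm2Z normrN1 mul1r. Qed.

Lemma norm20 : norm2 (0 : 'rV[R]_n) = 0.
Proof. by rewrite -(scale0r 0) norm2Z normr0 mul0r. Qed.

Lemma norm2D u v : norm2 (u + v) <= norm2 u + norm2 v.
Proof.
rewrite -(@ler_pXn2r _ 2)// ?nnegrE ?addr_ge0 ?norm2_ge0//.
rewrite sqr_norm2 !dotE (dotC v u) sqrrD -!sqr_norm2.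
have uv := dot_le_norm2 u v; lra.
Qed.

Lemma dist_norm2 u v : `|norm2 u - norm2 v| <= norm2 (u - v).
Proof.
have uv := norm2D (u - v) v; have vu := norm2D (v - u) u.
rewrite !subrK in uv vu; rewrite -(opprB u v) norm2N in vu.
by rewrite ler_norml; apply/andP; split; lra.
Qed.

Lemma coord_le_norm u i : `|u 0 i| <= `|u|.
Proof.
rewrite [leRHS]/Num.norm /= mx_normrE.
by apply/bigmax_geP; right => /=; exists (0, i).
Qed.

Lemma norm_le_norm2 u : `|u| <= norm2 u.
Proof.
rewrite [leLHS]/Num.norm /= mx_normrE; apply/bigmax_leP.
split=> [|[i j] _ /=]; first exact: norm2_ge0.
rewrite (ord1 i) -(@ler_pXn2r _ 2)// ?nnegrE ?norm2_ge0//.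
rewrite sqr_norm2 /dot (bigD1 j)//= real_normK ?num_real// expr2 lerDl.
by apply: sumr_ge0 => k _; rewrite -expr2 sqr_ge0.
Qed.

Lemma norm2_le_sum u : norm2 u <= \sum_(i < n) `|u 0 i|.
Proof.
rewrite [u in norm2 u]row_sum_delta.
elim/big_ind2 : _ => [|x1 x2 y1 y2 h1 h2|i _]; first by rewrite norm20.
  by rewrite (le_trans (norm2D _ _))// lerD.
rewrite norm2Z ler_piMr// /norm2 /dot (bigD1 i)//= big1 => [|j ji].
  by rewrite mxE !eqxx addr0 mulr1 sqrtr1.
by rewrite mxE (negbTE ji) andbF mulr0.
Qed.

Lemma norm2_le_norm u : norm2 u <= n%:R * `|u|.
Proof.
rewrite (le_trans (norm2_le_sum u))// mulr_natl.
rewrite -[n in _ *+ n]card_ord -sumr_const.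
by apply: ler_sum => i _; exact: coord_le_norm.
Qed.

(** The topology is that of the sup norm, so [norm2_le_norm] costs a factor [n]; the [+ 1] in the
    radius keeps the divisor positive. *)
Lemma lipschitz2_continuous {L : R} {h : 'rV[R]_n -> R} :
  lipschitz2 L h -> continuous h.
Proof.
move=> [L0 hL] x; apply/(@cvgrPdist_lt _ _ _ _ (nbhs_filter x)) => e e0.
have k0 : 0 < L * n%:R + 1 by rewrite ltr_wpDl// mulr_ge0.
apply/(@nbhs_normP R 'rV[R]_n x); exists (e / (L * n%:R + 1)).
  by rewrite /= divr_gt0.
move=> t /=; rewrite ltr_pdivlMr// mulrC => xt.
apply: le_lt_trans xt; apply: le_trans (hL x t) _.
rewrite mulrDl mul1r -mulrA -[leLHS]addr0 lerD//.
by rewrite ler_wpM2l// norm2_le_norm.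
Qed.

End Euclidean.

Lemma smoothing_parameter_lt1 {R : realType} {rho beta : R} :
  0 <= rho -> smoothing_parameter rho beta -> rho * beta < 1.
Proof.
move=> rho0 [beta0]; rewrite inver; case: eqVneq => [->|rhon0].
  by rewrite mul0r.
by rewrite lte_fin -ltr_pdivlMl ?mulr1// lt0r rhon0.
Qed.

(** * Gradients from a quadratic remainder *)

Section Gradient.
Context {R : realType} {m : nat}.

(** A name to which the linear structure required by [diff_unique] can be attached. *)
Definition dot_linear (xi h : 'rV[R]_m) : R := dot xi h.

Lemma dot_linear_is_linear xi : linear (dot_linear xi : _ -> R^o).
Proof. by move=> a u v; rewrite /dot_linear !dotE. Qed.

HB.instance Definition _ xi := GRing.isLinear.Build R 'rV[R]_m R^o _
  (dot_linear xi) (dot_linear_is_linear xi).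

(** A quadratic remainder is [o(h)], so it yields differentiability and the differential [<xi, .>]
    at once; the coordinates are then read off the basis vectors. *)
Lemma gradient_unique (F : 'rV[R]_m -> R) (y xi : 'rV[R]_m) (K : R) :
  0 <= K -> (forall h, `|F (y + h) - F y - dot xi h| <= K * norm2 h ^+ 2) ->
  gradient F y = xi.
Proof.
move=> K0 Fxi; have dF : 'd F y = dot_linear xi :> (_ -> _).
  apply: diff_unique.
    apply: (@lipschitz2_continuous _ _ (norm2 xi)); split.
      exact: norm2_ge0.
    move=> u v; rewrite -[_ - _]/(dot xi u - dot xi v) -dotNr -dotDr ler_norml.
    by rewrite lerNl -dotNl -(norm2N xi) {1}dot_le_norm2 norm2N dot_le_norm2.
  apply/eqaddoP => e e0.
  (* [K |h|_2^2 <= K m^2 |h|^2 <= c |h|^2] with the sup norm on the right, and [c |h| <= e] on the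
     ball of radius [e / c]. *)
  pose c := K * m%:R ^+ 2 + 1.
  have c0 : 0 < c by rewrite ltr_wpDl// mulr_ge0// sqr_ge0.
  apply/(@nbhs_normP R 'rV[R]_m 0); exists (e / c).
    by rewrite /= divr_gt0.
  move=> h /=; rewrite sub0r normrN ltr_pdivlMr// => /ltW hc.
  rewrite -[X in `|X|]/(F (h + y) - (F y + dot xi h)) opprD addrA (addrC h).
  apply: le_trans (Fxi h) _.
  apply: (@le_trans _ _ (`|h| * c * `|h|)); last first.
    by rewrite ler_wpM2r.
  apply: (@le_trans _ _ (K * (m%:R * `|h|) ^+ 2)).
    rewrite ler_wpM2l// ler_pXn2r ?nnegrE ?norm2_ge0 ?mulr_ge0//.
    exact: norm2_le_norm.
  have -> : `|h| * c * `|h| = K * (m%:R * `|h|) ^+ 2 + `|h| ^+ 2.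
    by rewrite /c; ring.
  by rewrite lerDl sqr_ge0.
apply/rowP => i; rewrite mxE dF /= /dot_linear /dot (bigD1 i)//= big1.
  by rewrite mxE !eqxx mulr1 addr0.
by move=> j ji; rewrite mxE (negbTE ji) andbF mulr0.
Qed.

End Gradient.

(** * Proximal points and the Moreau envelope *)

Section Prox.
Context {R : realType} {m : nat} {beta : R} {g : 'rV[R]_m -> R}.
Hypothesis beta_gt0 : 0 < beta.
Implicit Types (y u v h p : 'rV[R]_m).

Local Notation phi := (prox_objective beta g).
Local Notation is_prox y p := (forall v, phi y p <= phi y v).

(** Moving the centre changes the objective by an affine function of [u], which makes the minimizers
    for [y] and [y + h] comparable. *)
Lemma prox_objectiveD y h u :
  phi (y + h) u = phi y u - beta^-1 * dot (u - y) h + (2 * beta)^-1 * dot h h.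
Proof.
rewrite /prox_objective !sqr_norm2 !dotE (dotC u y) (dotC h u) (dotC h y).
by field; rewrite gt_eqF.
Qed.

(** Minimality of [p] tested at [p + v]: a subgradient inequality up to a second-order error, from
    which both the Clarke inclusion and the norm bound follow. *)
Lemma is_prox_le y p v : is_prox y p ->
  dot (beta^-1 *: (y - p)) v - (2 * beta)^-1 * dot v v <= g (p + v) - g p.
Proof.
move=> /(_ (p + v)); rewrite /prox_objective !sqr_norm2.
rewrite !dotE (dotC y p) (dotC v p) (dotC v y) => le_p.
rewrite -subr_ge0 -(subr_ge0 (_ + _)) in le_p *.
apply: le_trans le_p _; rewrite le_eqVlt; apply/orP; left; apply/eqP.
by field; rewrite gt_eqF.
Qed.

(** Outside the ball [A] the quadratic term exceeds [Lg |u - y|], the most that [g] can drop, so the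
    objective is at least its value at [y]. A minimizer over the compact [A] is thus global. *)
Lemma prox_exists Lg y : lipschitz2 Lg g -> exists p, is_prox y p.
Proof.
move=> gL; have [Lg0 g_lip] := gL.
pose A := [set u | norm2 (u - y) <= 2 * beta * Lg].
have Ay : A y by rewrite /A /= subrr norm20 !mulr_ge0// ltW.
have distC : continuous (fun u => norm2 (u - y)).
  apply: (@lipschitz2_continuous _ _ 1); split=> // u v.
  by rewrite mul1r (le_trans (dist_norm2 _ _))// opprB addrA subrK.
have Acompact : compact A.
  apply: bounded_closed_compact.
    exists (2 * beta * Lg + norm2 y); split; first exact: num_real.
    move=> M ltM u Au /=; apply: le_trans (ltW ltM).
    apply: le_trans (norm_le_norm2 u) _; rewrite -[u in leLHS](subrK y).
    by rewrite (le_trans (norm2D _ _))// lerD2r.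
  apply: (closed_comp (f := fun u => norm2 (u - y))
                      (D := [set r | r <= 2 * beta * Lg])).
    by move=> u _; exact: distC.
  exact: closed_le.
have phiC : continuous (phi y).
  move=> u; apply: (@cvgD _ _ _ _ (nbhs_filter u)).
    exact: lipschitz2_continuous gL u.
  apply: (@cvgM _ _ _ (nbhs_filter u)); first exact: cvg_cst.
  by apply: (@cvgM _ _ _ (nbhs_filter u)); exact: distC.
have [p Ap minp] := @EVT_min_rV _ _ (phi y) A (ex_intro _ _ Ay) Acompact
   (continuous_subspaceT phiC).
exists p => u; have [Au|nAu] := leP (norm2 (u - y)) (2 * beta * Lg).
  by apply: minp; rewrite inE.
apply: (@le_trans _ _ (phi y y)); first by apply: minp; rewrite inE.
rewrite /prox_objective subrr norm20 expr0n mulr0 addr0 -lerBlDl.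
apply: le_trans (le_trans (ler_norm _) (g_lip y u)) _.
rewrite -opprB norm2N expr2 mulrA ler_wpM2r ?norm2_ge0//.
by rewrite ler_pdivlMl ?mulr_gt0// ltW.
Qed.

Lemma proxP Lg y : lipschitz2 Lg g -> is_prox y (prox beta g y).
Proof.
move=> /(prox_exists _ y) [p py].
exact: (@getPex _ [set u | forall v, phi y u <= phi y v] (ex_intro _ p py)).
Qed.

Lemma moreauE y p : is_prox y p -> moreau beta g y = phi y p.
Proof.
move=> py; apply/le_anti/andP; split.
  by apply: ge_inf; [exists (phi y p) => _ [u _ <-]|exists p].
by apply: lb_le_inf; [exists (phi y p), p|move=> _ [u _ <-]].
Qed.

Lemma norm2_prox_le Lg y p : lipschitz2 Lg g -> is_prox y p ->
  norm2 (beta^-1 *: (y - p)) <= Lg.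
Proof.
move=> [Lg0 g_lip] /is_prox_le; set xi := _ *: _; clearbody xi => xi_le.
apply/ler_addgt0Pr => e e0.
have [x0|xn0] := eqVneq (norm2 xi) 0; first by rewrite x0 addr_ge0// ltW.
have xgt0 : 0 < norm2 xi by rewrite lt0r xn0 norm2_ge0.
(* Testing with [v = t xi] and dividing by [t |xi|] gives [|xi| - t |xi| / (2 beta) <= Lg]; this [t]
   makes the error exactly [e]. *)
pose t := 2 * beta * e / norm2 xi.
have t0 : 0 < t by rewrite divr_gt0// !mulr_gt0.
have := le_trans (xi_le (t *: xi)) (le_trans (ler_norm _) (g_lip _ _)).
rewrite [p + _]addrC addrK norm2Z gtr0_norm// !dotE -!sqr_norm2 => le2.
rewrite -(ler_pM2l (mulr_gt0 t0 xgt0)) -subr_ge0.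
rewrite -subr_ge0 in le2; apply: le_trans le2 _.
rewrite le_eqVlt; apply/orP; left; apply/eqP; rewrite /t.
by field; rewrite xn0 gt_eqF.
Qed.

(** The upper limit is an infimum of suprema over neighbourhoods, and each one contains pairs
    [(p, t)] with [t] small: quotients based at [p] itself suffice. *)
Lemma clarke_prox y p : is_prox y p ->
  clarke_subdifferential g p (beta^-1 *: (y - p)).
Proof.
move=> /is_prox_le; set xi := _ *: _; clearbody xi => xi_le v.
apply: le_ereal_inf_tmp => _ [V [[A B] /= [nA nB] sAB] <-].
apply/lee_addgt0Pr => e e0.
pose k := (2 * beta)^-1 * dot v v.
have [t [Bt t0 te]] : exists t : R, [/\ B t, 0 < t & t * k <= e].
  (* [t <= e / (k + 1)] also covers [k = 0], that is [v = 0]. *)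
  have k1 : 0 < k + 1.
    by rewrite ltr_wpDl// mulr_ge0 ?dot_ge0// invr_ge0 mulr_ge0// ltW.
  near (0 : R)^'+ => t; exists t; split; near: t => //.
    exact: nbhs_right_gt.
  near=> t; apply: (@le_trans _ _ (t * (k + 1))).
    by rewrite ler_wpM2l// ?lerDl//; near: t; exact: nbhs_right_ge.
  rewrite -ler_pdivlMr//; near: t.
  by apply: nbhs_right_le; rewrite divr_gt0.
apply: (@le_trans _ _ (((g (p + t *: v) - g p) / t)%:E + e%:E)%E); last first.
  rewrite leeD2r//; apply: ereal_sup_ubound; exists (p, t) => //.
  by apply: sAB; split=> //; exact: nbhs_singleton.
rewrite -EFinD lee_fin -lerBlDr ler_pdivlMr//.
apply: le_trans (xi_le _); rewrite !dotE -/k.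
have -> : (2 * beta)^-1 * (t * (t * dot v v)) = t * (t * k) by rewrite /k; ring.
by rewrite mulrC -mulrBr ler_pM2l// lerD2l lerN2.
Unshelve. all: by end_near. Qed.

(* Convexity of [g + rho / 2 * |.|^2] at the midpoint of [u] and [p] suffices,
   at the price of the constant 4 instead of the optimal 2. *)
Lemma prox_growth rho y p u : weakly_convex rho g -> is_prox y p ->
  phi y p + (beta^-1 - rho) / 4 * dot (u - p) (u - p) <= phi y u.
Proof.
move=> g_cvx py.
pose q := 2^-1 *: u + (1 - 2^-1) *: p.
have mid : g q + rho / 2 * norm2 q ^+ 2 <=
    2^-1 * (g u + rho / 2 * norm2 u ^+ 2) +
    (1 - 2^-1) * (g p + rho / 2 * norm2 p ^+ 2).
  have h0 : (0 : R) <= 2^-1 by rewrite invr_ge0.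
  have h1 : (2^-1 : R) <= 1 by rewrite invf_le1 ?ler1n.
  exact: (g_cvx (Itv01 h0 h1) u p (mem_set I) (mem_set I)).
have := py q; rewrite -subr_ge0 => minq; rewrite -subr_ge0 in mid.
(* In the sum of [mid] and [minq] the value [g q] cancels; by the parallelogram identity, twice this
   sum is the claim. *)
rewrite -subr_ge0; have := mulr_ge0 (ler0n R 2) (addr_ge0 mid minq).
move=> /le_trans; apply; rewrite le_eqVlt; apply/orP; left; apply/eqP.
rewrite /prox_objective !sqr_norm2 /q !dotE.
rewrite (dotC p u) (dotC y u) (dotC y p).
by field; rewrite gt_eqF.
Qed.

Lemma gradient_moreau Lg rho y p : lipschitz2 Lg g -> weakly_convex rho g ->
  rho * beta < 1 -> is_prox y p ->
  gradient (moreau beta g) y = beta^-1 *: (y - p).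
Proof.
move=> gL g_cvx rho_beta py.
pose c := (beta^-1 - rho) / 4.
have c0 : 0 < c.
  by rewrite divr_gt0// subr_gt0 -(ltr_pM2r beta_gt0) mulVf ?gt_eqF//.
have b0 : 0 <= (2 * beta)^-1 by rewrite invr_ge0 mulr_ge0// ltW.
have d0 : 0 <= (4 * c * beta ^+ 2)^-1.
  by rewrite invr_ge0 mulr_ge0 ?sqr_ge0// mulr_ge0 ?ltW.
(* The first summand bounds the remainder from above, by testing [p] in the problem centred at
   [y + h]. The second bounds it from below: growth at the minimizer [q] for [y + h], with the cross
   term in [q - p] absorbed by completing the square. *)
apply: (@gradient_unique _ _ _ _ _ ((2 * beta)^-1 + (4 * c * beta ^+ 2)^-1)) => [|h].
  exact: addr_ge0.
have [q qyh] := prox_exists _ (y + h) gL.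
rewrite (moreauE _ _ py) (moreauE _ _ qyh) sqr_norm2.
have growth := prox_growth _ _ _ q g_cvx py; rewrite -/c in growth.
(* c |q - p - h / (2 c beta)|^2, expanded *)
have square : 0 <= c * dot (q - p) (q - p) - beta^-1 * dot (q - p) h
                   + (4 * c * beta ^+ 2)^-1 * dot h h.
  have := mulr_ge0 (ltW c0) (dot_ge0 (q - p - (2 * c * beta)^-1 *: h)).
  move=> /le_trans; apply; rewrite le_eqVlt; apply/orP; left; apply/eqP.
  set d := q - p; clearbody d; rewrite !dotE (dotC h d).
  by field; rewrite !gt_eqF.
have hh := mulr_ge0 b0 (dot_ge0 h); have dh := mulr_ge0 d0 (dot_ge0 h).
have := qyh p; rewrite !prox_objectiveD -(opprB y p).
have -> : q - y = (q - p) - (y - p) by rewrite opprB addrA subrK.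
move: (q - p) (y - p) growth square => d e growth square.
rewrite !dotE => upper.
rewrite ler_norml; apply/andP; split; lra.
Qed.

End Prox.

Lemma norm2_adjoint_le {R : realType} {n m : nat}
    (T : {linear 'rV[R]_n -> 'rV[R]_m}) (K : R) (y : 'rV[R]_m) :
  norm2 y <= K -> norm2 (adjoint T y) <= K * op_norm (adjoint T).
Proof.
move=> yK; have K_ge0 := le_trans (norm2_ge0 y) yK.
have adjZ a (v : 'rV[R]_m) : adjoint T (a *: v) = a *: adjoint T v.
  by rewrite /adjoint scalemxAl.
have [K0|Kn0] := eqVneq K 0.
  have /norm2_eq0-> : norm2 y = 0 by apply/le_anti; rewrite norm2_ge0 -K0 yK.
  by rewrite -(scale0r 0) adjZ norm2Z normr0 K0 !mul0r.
have K_gt0 : 0 < K by rewrite lt0r Kn0.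
rewrite -ler_pdivrMl// -(gtr0_norm (_ : 0 < K^-1)) ?invr_gt0//.
rewrite -norm2Z -adjZ; apply: ub_le_sup; last first.
  exists (K^-1 *: y) => //=.
  by rewrite norm2Z gtr0_norm ?invr_gt0// ler_pdivrMl// mulr1.
(* The supremum defining [op_norm] is an upper bound only if its set is bounded; coordinates of [v]
   are at most 1 in absolute value. *)
exists (\sum_(i < m) norm2 (adjoint T (delta_mx 0 i))) => _ [v /= v1 <-].
rewrite [v in adjoint _ v]row_sum_delta.
have -> : adjoint T (\sum_j v 0 j *: delta_mx 0 j) =
    \sum_j v 0 j *: adjoint T (delta_mx 0 j).
  by rewrite /adjoint mulmx_suml; apply: eq_bigr => j _; rewrite scalemxAl.
elim/big_ind2 : _ => [|x1 x2 y1 y2 h1 h2|i _]; first by rewrite norm20.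
  by rewrite (le_trans (norm2D _ _))// lerD.
rewrite norm2Z ler_piMl ?norm2_ge0//.
by rewrite (le_trans (coord_le_norm v i))// (le_trans (norm_le_norm2 v)).
Qed.

(** * Suprema over a compact set: diameter, gap and gradient bound *)

Section BoundedSet.
Context {R : realType} {n : nat} {C : set 'rV[R]_n}.
Hypothesis C_compact : compact C.

Lemma compact_norm2_bounded : exists B, forall x, C x -> norm2 x <= B.
Proof.
have [B [_ CB]] := compact_bounded C_compact.
exists (n%:R * (B + 1)) => x Cx; apply: le_trans (norm2_le_norm x) _.
by rewrite ler_wpM2l//; apply: (CB (B + 1)) Cx; rewrite ltrDl.
Qed.

Lemma norm2B_le_diameter x y : C x -> C y -> norm2 (x - y) <= diameter C.
Proof.
move=> Cx Cy; have [B CB] := compact_norm2_bounded.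
apply: ub_le_sup; last by exists (x, y).
exists (B + B) => _ [[u v] /= [Cu Cv] <-].
by rewrite (le_trans (norm2D _ _))// norm2N lerD// CB.
Qed.

Lemma dot_le_fw_gap w x s : C s -> dot w (x - s) <= fw_gap C w x.
Proof.
move=> Cs; have [B CB] := compact_norm2_bounded.
apply: ub_le_sup; last by exists s.
exists (norm2 w * (norm2 x + B)) => _ [u Cu <-].
rewrite (le_trans (dot_le_norm2 _ _))// ler_wpM2l ?norm2_ge0//.
by rewrite (le_trans (norm2D _ _))// norm2N lerD2l CB.
Qed.

(** For use with [v], [v'] the gradients of [f] at [x], [z] and [a] the common term [adjoint T xi].
    Moving the base point costs the first product, changing the linear form the second. *)
Lemma fw_gap_perturb (v v' a x z : 'rV[R]_n) : C z ->
  fw_gap C (v' + a) z <= fw_gap C (v + a) x +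
    (norm2 (v + a) * norm2 (z - x) + norm2 (v' - v) * diameter C).
Proof.
move=> Cz; apply: ge_sup; first by exists (dot (v' + a) (z - z)), z.
move=> _ [s Cs <-].
have -> : dot (v' + a) (z - s) =
    dot (v + a) (x - s) + (dot (v + a) (z - x) + dot (v' - v) (z - s)).
  by rewrite !dotE; ring.
apply: lerD; first exact: dot_le_fw_gap.
apply: lerD; first exact: dot_le_norm2.
apply: le_trans (dot_le_norm2 _ _) _.
by rewrite ler_wpM2l ?norm2_ge0// norm2B_le_diameter.
Qed.

(** A Lipschitz gradient on a set of finite diameter is bounded, so the supremum is a true upper
    bound. *)
Lemma norm2_gradient_le (f : 'rV[R]_n -> R) L x :
  lipschitz2_on C L (gradient f) -> 0 <= L -> C x ->
  norm2 (gradient f x) <= max_gradient_norm C f.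
Proof.
move=> fL L0 Cx; apply: ub_le_sup; last by exists x.
exists (L * diameter C + norm2 (gradient f x)) => _ [u Cu <-].
rewrite -[gradient f u in leLHS](subrK (gradient f x)).
rewrite (le_trans (norm2D _ _))// lerD2r (le_trans (fL _ _ Cu Cx))//.
by rewrite ler_wpM2l// norm2B_le_diameter.
Qed.

End BoundedSet.

(** * Comparison of the two gaps *)

Theorem lemma6p11 (R : realType) (n m : nat) (C : set 'rV[R]_n)
    (f : 'rV[R]_n -> R) (T : {linear 'rV[R]_n -> 'rV[R]_m})
    (g : 'rV[R]_m -> R) (Lgradf Lg rho M : R)
    (C_nonempty : C !=set0) (C_compact : compact C) (C_convex : convex_set C)
    (f_C1 : exists U : set 'rV[R]_n,
      [/\ open U, C `<=` U & continuously_differentiable_on U f])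
    (Lgradf_gt0 : 0 < Lgradf)
    (gradf_lip : lipschitz2_on C Lgradf (gradient f))
    (g_lip : lipschitz2 Lg g)
    (rho_ge0 : 0 <= rho) (g_wcvx : weakly_convex rho g)
    (M_gt0 : 0 < M) (lift : proximal_lift C T g rho M)
    (x : 'rV[R]_n) (Cx : C x)
    (beta : R) (hbeta : smoothing_parameter rho beta)
    (z : 'rV[R]_n) (hz : lift_point C T g M beta x z) :
  let xi := gradient (moreau beta g) (T x) in
  clarke_subdifferential g (T z) xi /\
  subgradient_gap C f T z xi <=
    smoothed_gap C f T g beta x + lift_constant C f T Lgradf Lg M * beta.
Proof.
move=> xi; have [beta_gt0 _] := hbeta; have [Cz Tz zx] := hz.
have Tz_prox := proxP beta_gt0 _ (T x) g_lip; rewrite -Tz in Tz_prox.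
have xiE : xi = beta^-1 *: (T x - T z).
  have rho_beta := smoothing_parameter_lt1 rho_ge0 hbeta.
  exact: gradient_moreau g_lip g_wcvx rho_beta Tz_prox.
split; first by rewrite xiE; exact: clarke_prox.
have Lg_ge0 : 0 <= Lg by case: g_lip.
have xi_le : norm2 xi <= Lg by rewrite xiE; exact: norm2_prox_le g_lip Tz_prox.
rewrite /subgradient_gap /smoothed_gap -/xi.
(* Since [T x - T z = beta xi], the lift inequality and [|xi| <= Lg] give this bound. *)
have {}zx : norm2 (z - x) <= M * Lg * beta.
  apply: (le_trans zx); rewrite -mulrA ler_pM2l//.
  rewrite -opprB norm2N -ler_pdivrMr// mulrC.
  by rewrite -(gtr0_norm (_ : 0 < beta^-1)) ?invr_gt0// -norm2Z -xiE.
have w_le : norm2 (gradient f x + adjoint T xi) <=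
    max_gradient_norm C f + Lg * op_norm (adjoint T).
  apply: le_trans (norm2D _ _) _; apply: lerD.
    exact: norm2_gradient_le gradf_lip (ltW Lgradf_gt0) Cx.
  exact: norm2_adjoint_le.
clearbody xi; apply: le_trans.
  exact: (fw_gap_perturb C_compact (gradient f x) (gradient f z) _ x z Cz).
rewrite lerD2l.
(* The constant is split along the two error terms of [fw_gap_perturb]. *)
have -> : lift_constant C f T Lgradf Lg M * beta =
    (max_gradient_norm C f + Lg * op_norm (adjoint T)) * (M * Lg * beta) +
    Lgradf * (M * Lg * beta) * diameter C.
  by rewrite /lift_constant; ring.
apply: lerD; first by rewrite ler_pM ?norm2_ge0.
rewrite ler_wpM2r//.
  exact: le_trans (norm2_ge0 _) (norm2B_le_diameter C_compact _ _ Cz Cz).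
by apply: le_trans (gradf_lip _ _ Cz Cx) _; rewrite ler_pM2l.
Qed.
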